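(* Let $m,n\in\mathbb N$ with $m\leq n$, let $(a_{rk})_{1\leq r\leq m,\,1\leq k\leq n}$ be a complex $m\times n$ matrix, and put $a=(a_{1k})_{k=1}^n\in\mathbb C^n$ and $g_k=(a_{2k},a_{3k},\dots,a_{mk})\in\mathbb C^{m-1}$ for $1\leq k\leq n$. Let $C=\gamma(g_1,\dots,g_n)=\big((g_k,g_r)\big)_{k,r=1}^n$. Let $\lambda=(\lambda_k)_{k=1}^n\in\mathbb C^n$ with $\lambda_k\neq0$ for all $k$, let $C(\lambda)=\mathrm{diag}(\lambda_1,\dots,\lambda_n)+C$, and assume $\det C(\lambda)\neq 0$. Fix square roots $\sqrt{\lambda_k}$ and set $x_{rk}=a_{rk}/\sqrt{\lambda_k}$ and $y_r=(x_{r1},x_{r2},\dots,x_{rn})\in\mathbb C^n$ for $1\leq r\leq m$. Then $$1+\big(C(\lambda)^{-1}a,a\big)=\frac{\det\big(I_m+\gamma(y_1,y_2,\dots,y_m)\big)}{\det\big(I_{m-1}+\gamma(y_2,\dots,y_m)\big)}=1+\Delta(y_1,y_2,\dots,y_m).$$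
   Context: For vectors $v_1,\dots,v_p$, $\gamma(v_1,\dots,v_p)=\big((v_k,v_l)\big)_{k,l=1}^p$ is their Gram matrix, where the pairing is the bilinear one, $(x,y)=\sum_k x_ky_k$ (no complex conjugation). $I_p$ is the $p\times p$ identity matrix. By definition $$\Delta(y_1,\dots,y_k)=\frac{\det\big(I+\gamma(y_1,y_2,\dots,y_k)\big)}{\det\big(I+\gamma(y_2,\dots,y_k)\big)}-1 .$$ For $m=1$, the vectors $g_k$ lie in the zero space (so $C=0$) and the determinant of the empty matrix is $1$. *)

(* Defs.v *)
From mathcomp Require Import all_boot all_order all_algebra.

Set Implicit Arguments.
Unset Strict Implicit.
Unset Printing Implicit Defensive.
Import GRing.Theory.
Local Open Scope ring_scope.

(* The pairing is bilinear, even over the complex numbers: no conjugation. *)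
Definition pairing (F : fieldType) (n : nat) (x y : 'cV[F]_n) : F :=
  \sum_(k < n) x k 0 * y k 0.

Definition gram (F : fieldType) (p n : nat) (v : 'I_p -> 'cV[F]_n) : 'M[F]_p :=
  \matrix_(k, l) pairing (v k) (v l).

Definition behead_fam (F : fieldType) (p n : nat) (y : 'I_p.+1 -> 'cV[F]_n) :
    'I_p -> 'cV[F]_n :=
  fun i => y (lift ord0 i).

(* Meaningful only when the denominator is nonzero (in MathComp, x / 0 = 0). *)
Definition Delta (F : fieldType) (p n : nat) (y : 'I_p.+1 -> 'cV[F]_n) : F :=
  \det (1%:M + gram y) / \det (1%:M + gram (behead_fam y)) - 1.

(* Main.v *)
(* Let D = S^2 be the diagonal matrix of the lambda_k, S that of the chosen roots,
   and let the rows of N be the y_r, so that A = N S. Then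
   det (D + A^T A) = det D * det (1 + N^T N) = det D * det (1 + N N^T), and N N^T
   is the Gram matrix of the y_r; the same holds for A without its first row, where
   the left-hand side is det C(lambda). Since the full matrix D + A^T A is
   C(lambda) + a a^T, the rank one case of
   det (C + V U) = det C * det (1 + U C^-1 V) gives the quotient. *)
Require Import Defs.
From mathcomp Require Import all_boot all_order all_algebra.
From mathcomp Require Import reals.
From mathcomp Require Import complex.

Set Implicit Arguments.
Unset Strict Implicit.
Unset Printing Implicit Defensive.
Import Order.TTheory GRing.Theory Num.Theory.
Local Open Scope ring_scope.
Local Open Scope complex_scope.

Lemma det_addmx_mulmx (K : comUnitRingType) (m n : nat) (D : 'M[K]_n)
    (U : 'M[K]_(m, n)) (V : 'M[K]_(n, m)) :
  D \in unitmx ->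
  \det (D + V *m U) = \det D * \det (1%:M + U *m invmx D *m V).
Proof.
move=> uD.
(* Two block triangular factorizations of [[1, -U], [V, D]]. *)
have: block_mx 1%:M 0 V 1%:M *m block_mx 1%:M (- U) 0 (D + V *m U)
    = block_mx (1%:M + U *m invmx D *m V) (- U) 0 D
      *m block_mx 1%:M 0 (invmx D *m V) 1%:M.
  rewrite !mulmx_block !mul1mx !mulmx1 !mul0mx !mulmx0 !addr0 !add0r.
  by rewrite mulmxN addrC addrK mulNmx !mulmxA addrK mulmxV // mul1mx.
move/(congr1 determinant); rewrite !det_mulmx !det_lblock !det_ublock !det1.
by rewrite !mul1r !mulr1 mulrC => ->; rewrite mulrC.
Qed.

Lemma gramE (F : fieldType) (p n : nat) (v : 'I_p -> 'cV[F]_n) :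
  gram v = (\matrix_(r, k) v r k 0) *m (\matrix_(r, k) v r k 0)^T.
Proof. by apply/matrixP => i j; rewrite !mxE; apply: eq_bigr => k _; rewrite !mxE. Qed.

Lemma pairingE (F : fieldType) (n : nat) (x y : 'cV[F]_n) :
  pairing x y = (y^T *m x) 0 0.
Proof. by rewrite mxE; apply: eq_bigr => k _; rewrite !mxE mulrC. Qed.

(** Dividing column [k] of [M] by the root [s k 0] lets the diagonal matrix of the roots factor out
    of the sum on both sides. *)
Lemma det_diag_add_gram (F : fieldType) (p n : nat) (lam s : 'cV[F]_n)
    (M : 'M[F]_(p, n)) :
  (forall k, lam k 0 != 0) -> (forall k, s k 0 ^+ 2 = lam k 0) ->
  \det (diag_mx lam^T + M^T *m M)
    = \det (diag_mx lam^T)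
      * \det (1%:M + gram (fun r => \col_k (M r k / s k 0))).
Proof.
move=> lam0 s2.
set N : 'M_(p, n) := \matrix_(r, k) (M r k / s k 0).
set E := diag_mx (\row_k s k 0).
have s0 k : s k 0 != 0 by rewrite -sqrf_eq0 s2.
have ME : M = N *m E.
  by apply/matrixP => i j; rewrite mul_mx_diag !mxE divfK.
have DE : diag_mx lam^T = E *m E.
  by apply/matrixP => i j; rewrite mul_mx_diag !mxE -s2 expr2 mulrnAl; case: eqP => // ->.
have -> : gram (fun r => \col_k (M r k / s k 0)) = N *m N^T.
  by rewrite gramE; congr (_ *m _^T); apply/matrixP => i j; rewrite !mxE.
have -> : diag_mx lam^T + M^T *m M = E *m (1%:M + N^T *m N) *m E.
  by rewrite ME DE trmx_mul tr_diag_mx mulmxDr mulmxDl mulmx1 !mulmxA.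
(* With [D = 1], this trades [N^T *m N] for [N *m N^T]. *)
rewrite DE !det_mulmx det_addmx_mulmx ?unitmx1 // invmx1 mulmx1 det1 mul1r.
by rewrite mulrAC.
Qed.

(* The number m of rows is p.+1; row r + 1 of the paper is row r here. *)
Theorem theorem5p3 (R : realType) (p n : nat) (hmn : (p.+1 <= n)%N)
    (A : 'M[R[i]]_(p.+1, n)) (lam s : 'cV[R[i]]_n)
    (hlam : forall k : 'I_n, lam k 0 != 0)
    (hs : forall k : 'I_n, s k 0 ^+ 2 = lam k 0) :
  let a : 'cV[R[i]]_n := \col_k A ord0 k in
  let g : 'I_n -> 'cV[R[i]]_p := fun k => \col_r A (lift ord0 r) k in
  let Clam : 'M[R[i]]_n := diag_mx lam^T + gram g in
  let y : 'I_p.+1 -> 'cV[R[i]]_n := fun r => \col_k (A r k / s k 0) in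
  \det Clam != 0 ->
  [/\ \det (1%:M + gram (behead_fam y)) != 0,
      1 + pairing (invmx Clam *m a) a
        = \det (1%:M + gram y) / \det (1%:M + gram (behead_fam y))
    & \det (1%:M + gram y) / \det (1%:M + gram (behead_fam y))
        = 1 + Delta y].
Proof.
move=> a g Clam y Clam0.
set B : 'M_(p, n) := \matrix_(r, k) A (lift ord0 r) k.
have ClamE : Clam = diag_mx lam^T + B^T *m B.
  by congr (_ + _); apply/matrixP => i j; rewrite !mxE; apply: eq_bigr => k _; rewrite !mxE.
(* The first row of [A] splits off as a rank one term. *)
have AE : A^T *m A = a *m a^T + B^T *m B.
  apply/matrixP => i j; rewrite !mxE big_ord_recl big_ord1 !mxE.
  by congr (_ + _); apply: eq_bigr => k _; rewrite !mxE.
have detA := det_diag_add_gram A hlam hs.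
have detB := det_diag_add_gram B hlam hs.
have gB : gram (fun r => \col_k (B r k / s k 0)) = gram (behead_fam y).
  by apply/matrixP => i j; rewrite !mxE; apply: eq_bigr => k _; rewrite !mxE.
rewrite gB -ClamE in detB.
have uC : Clam \in unitmx by rewrite unitmxE unitfE.
(* Here [U = a^T] and [V = a], so the last determinant is that of a 1 x 1 matrix. *)
rewrite AE addrCA -ClamE addrC det_addmx_mulmx // det_mx11 in detA.
rewrite mxE [1%:M _ _]mxE -mulmxA -pairingE in detA.
(* By [detB] the denominator is a factor of [\det Clam], hence nonzero. *)
move: (Clam0); rewrite detB mulf_eq0 negb_or => /andP[_ G0].
split=> //; last by rewrite /Delta [1 + _]addrC subrK.
(* Times [\det Clam], both sides become [\det (diag_mx lam^T) * \det (1%:M + gram y)]. *)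
apply: (mulfI Clam0); rewrite detA detB.
by rewrite mulrACA divff // mulr1.
Qed.
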